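(* Let $G$ be a (finite) connected multigraph without loops and let $q=p^d$ with $p$ an odd prime and $d\in\mathbb N$, $d\ge1$. For each $\alpha\in(\mathbb F_q^* )^{E(G)}$ let $W^*=W^*(\alpha,G)$ be any nonempty subset $W\subseteq V(G)$ of minimum cardinality with $s(\alpha,G/W)\neq0$, let $r^*(G,\alpha)=|V(G)|-|W^*|$, and put $$ S(r,q)=\sum_{\substack{\alpha\in(\mathbb F_q^* )^{E(G)}\\ r^*(G,\alpha)=r}}\eta\bigl(s(\alpha,G/W^* )\bigr). $$ Then $$ F_G(q)=\sum_{\substack{0\le r\le |V(G)|-1\\ r \text{ even}}}\left[\frac{g(q)}{q}\right]^{r}S(r,q). $$
   Context: $\mathbb F_q$ is the finite field with $q$ elements and $\mathbb F_q^*$ its set of nonzero elements. Flow polynomial: fix an arbitrary orientation of the edges of $G$, each edge $e$ going from $i(e)$ to $f(e)$, and let $\varepsilon_{ve}=-1$ if $v=i(e)$, $\varepsilon_{ve}=1$ if $v=f(e)$, $\varepsilon_{ve}=0$ if $e$ is not incident to $v$. For an abelian group $A_q$ of order $q$ (here the additive group of $\mathbb F_q$ may be taken), $F_G(q)$ is the number of nowhere-zero flows, i.e. of families $(k_e)_{e\in E(G)}$ of nonzero elements of $A_q$ such that $\sum_{e\in E(G)}\varepsilon_{ve}k_e=0$ for every $v\in V(G)$. This number is independent of the orientation and of the choice of the group of order $q$. $\eta$ is the quadratic character of $\mathbb F_q$: $\eta(0)=0$, and for $x\ne0$, $\eta(x)=1$ if $x$ is a square in $\mathbb F_q$ and $\eta(x)=-1$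 otherwise. $g(q)$ is the quadratic Gaussian sum of $\mathbb F_q$: $g(q)=(-1)^{d-1}\sqrt q$ if $p\equiv 1 \pmod 4$ and $g(q)=(-1)^{d-1}i^d\sqrt q$ if $p\equiv 3\pmod 4$, where $i$ is the imaginary unit. For nonempty $W\subseteq V(G)$, $G/W$ is the multigraph obtained from $G$ by identifying all vertices of $W$ to a single vertex and deleting all edges with both endpoints in $W$; all other edges are kept (parallel edges included), with the same weights $\alpha_e$ as in $G$. For a connected multigraph $H$ with edge weights $\alpha_e$, $s(\alpha,H)=\sum_{T\in\tau(H)}\prod_{e\in E(T)}\alpha_e\in\mathbb F_q$, where $\tau(H)$ is the set of spanning trees of $H$; if $H$ has a single vertex, $s(\alpha,H)=1$. *)

(* Defs.v *)
From mathcomp Require Import all_boot all_order all_algebra all_field.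

Set Implicit Arguments.
Unset Strict Implicit.
Unset Printing Implicit Defensive.

Import Order.TTheory GRing.Theory Num.Theory.
Local Open Scope ring_scope.

(* Parallel edges are distinct elements of [edge] with the same [ends];
   a loop is an edge with a single end. *)
Record multigraph := Multigraph {
  vertex : finType;
  edge : finType;
  ends : edge -> {set vertex};
  endsP : forall e, (0 < #|ends e| <= 2)%N
}.

Definition loopless (H : multigraph) : Prop :=
  forall e : edge H, #|ends e| = 2%N.

Definition adj_by (H : multigraph) (T : {set edge H}) : rel (vertex H) :=
  fun u v => [exists e in T, ends e == [set u; v]].

(* Connectedness of the spanning subgraph with edge set T; the null graph
   counts as disconnected. *)
Definition connected_by (H : multigraph) (T : {set edge H}) : bool :=
  (0 < #|vertex H|)%N &&
  [forall u, [forall v, connect (adj_by T) u v]].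

Definition connected (H : multigraph) : bool := connected_by [set: edge H].

(* The list (v_0, e_0), ..., (v_k, e_k) encodes the cycle
   v_0 e_0 v_1 e_1 ... v_k e_k v_0. Two parallel edges form a cycle (k = 1)
   and a loop forms a cycle (k = 0). *)
Definition is_cycle (H : multigraph) (T : {set edge H})
    (c : seq (vertex H * edge H)) : bool :=
  [&& c != [::],
      uniq (unzip1 c),
      uniq (unzip2 c),
      all (fun a => a.2 \in T) c
    & cycle (fun a b => ends a.2 == [set a.1; b.1]) c].

(* The vertices of a cycle are distinct, so its length is at most
   #|vertex H|; the bound only serves to make the predicate boolean. *)
Definition acyclic (H : multigraph) (T : {set edge H}) : bool :=
  ~~ [exists n : 'I_#|vertex H|.+1,
       [exists c : n.-tuple (vertex H * edge H), is_cycle T c]].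

Definition spanning_tree (H : multigraph) (T : {set edge H}) : bool :=
  connected_by T && acyclic T.

(* When H has a single vertex, the only spanning tree is set0 and the
   value is 1. *)
Definition tree_sum (R : comNzRingType) (H : multigraph) (a : edge H -> R) : R :=
  \sum_(T : {set edge H} | spanning_tree T) \prod_(e in T) a e.

Section Contraction.
Variables (G : multigraph) (W : {set vertex G}).

(* [None] is the vertex to which the elements of W are identified (this is
   the intended graph only when W is nonempty). *)
Definition contract_vertex : finType := option {v : vertex G | v \notin W}.
Definition contract_edge : finType := {e : edge G | ~~ (ends e \subset W)}.

Definition contract_proj (v : vertex G) : contract_vertex := insub v.

Definition contract_ends (e : contract_edge) : {set contract_vertex} :=
  contract_proj @: ends (val e).

Fact contract_endsP (e : contract_edge) : (0 < #|contract_ends e| <= 2)%N.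
Proof.
have /andP[e_gt0 e_le2] := endsP (val e).
rewrite (leq_trans (leq_imset_card _ _) e_le2) andbT.
by have /card_gt0P[v ve] := e_gt0; apply/card_gt0P;
  exists (contract_proj v); apply: imset_f.
Qed.

Definition contract : multigraph := Multigraph contract_endsP.

Definition contract_weight (R : Type) (a : edge G -> R) : edge contract -> R :=
  fun e => a (val e).

End Contraction.

Definition is_orientation (G : multigraph) (ini fin : edge G -> vertex G) : Prop :=
  forall e, ends e = [set ini e; fin e].

Definition incidence (G : multigraph) (ini fin : edge G -> vertex G)
    (v : vertex G) (e : edge G) : int :=
  if v == ini e then -1 else if v == fin e then 1 else 0.

Definition nowhere_zero (A : finZmodType) (E : finType) (k : {ffun E -> A}) : bool :=
  [forall e, k e != 0].

Definition is_flow (G : multigraph) (ini fin : edge G -> vertex G)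
    (A : finZmodType) (k : {ffun edge G -> A}) : bool :=
  [forall v, \sum_e k e *~ incidence ini fin v e == 0].

Definition flow_number (G : multigraph) (ini fin : edge G -> vertex G)
    (A : finZmodType) : nat :=
  #|[set k : {ffun edge G -> A} | nowhere_zero k && is_flow ini fin k]|.

Definition eta (F : finFieldType) (x : F) : int :=
  if x == 0 then 0 else if [exists y, x == y ^+ 2] then 1 else -1.

(* Closed form of the quadratic Gaussian sum of the field with p ^ d elements,
   for p an odd prime. *)
Definition gauss_sum (C : numClosedFieldType) (p d : nat) : C :=
  if (p %% 4)%N == 1%N then (-1) ^+ d.-1 * sqrtC (p ^ d)%N%:R
  else (-1) ^+ d.-1 * 'i ^+ d * sqrtC (p ^ d)%N%:R.

Definition contract_tree_sum (F : finFieldType) (G : multigraph)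
    (alpha : {ffun edge G -> F}) (W : {set vertex G}) : F :=
  tree_sum (contract_weight (W := W) alpha).

Definition is_Wstar (F : finFieldType) (G : multigraph)
    (alpha : {ffun edge G -> F}) (W : {set vertex G}) : Prop :=
  [/\ W != set0,
      contract_tree_sum alpha W != 0
    & forall W' : {set vertex G},
        W' != set0 -> contract_tree_sum alpha W' != 0 -> (#|W| <= #|W'|)%N].

Definition rstar (F : finFieldType) (G : multigraph)
    (Wstar : {ffun edge G -> F} -> {set vertex G})
    (alpha : {ffun edge G -> F}) : nat :=
  (#|vertex G| - #|Wstar alpha|)%N.

(* S(r, q) computed with the choice alpha |-> Wstar alpha of minimum sets. *)
Definition eta_sum (F : finFieldType) (G : multigraph)
    (Wstar : {ffun edge G -> F} -> {set vertex G}) (r : nat) : int :=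
  \sum_(alpha : {ffun edge G -> F} |
          nowhere_zero alpha && (rstar Wstar alpha == r))
    eta (contract_tree_sum alpha (Wstar alpha)).

(* Main.v *)
Require Import Defs.
From mathcomp Require Import all_boot all_order all_algebra all_field.
From mathcomp Require Import all_fingroup ring zify.

(** Let q = #|F| and nu t = q [t = 0] - 1, the sum of psi (s t) over s <> 0 for
    any nontrivial additive character psi. For a fixed potential x on the
    vertices, with y_e = x_(fin e) - x_(ini e), the substitution
    k_e = alpha_e y_e on the edges with y_e <> 0 turns nu (sum_e alpha_e y_e^2)
    into nu (sum_e k_e y_e). Summing the latter over x detects flows, so
    (q - 1) q^|V| F_G(q) is the sum over alpha of sum_x nu (Q_alpha x), where
    Q_alpha is the quadratic form of the weighted Laplacian. By the matrix-tree
    theorem s(alpha, G/W) is the principal minor of the Laplacian on V \ W, so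
    minimality of W* makes the Schur complement of its block on V \ W* vanish:
    Q_alpha is congruent to that invertible block plus zero, and diagonalising
    the block evaluates the sum over x, which is zero in odd rank. Only
    g(q)^2 = eta(-1) q enters. *)

Import Order.TTheory GRing.Theory Num.Theory.
Local Open Scope ring_scope.

Set Implicit Arguments.
Unset Strict Implicit.

(** * The quadratic character *)

Section QuadraticCharacter.
Variable F : finFieldType.
Hypothesis two_neq0 : 2%:R != 0 :> F.
Local Notation q := (#|F|%:R : int).

Lemma eta0 : eta (0 : F) = 0.
Proof. by rewrite /eta eqxx. Qed.

Lemma eta_neq0 (x : F) : x != 0 ->
  eta x = if [exists y, x == y ^+ 2] then 1 else -1.
Proof. by rewrite /eta => /negPf ->. Qed.

Lemma eta_sqr (x : F) : x != 0 -> eta (x ^+ 2) = 1.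
Proof.
move=> x0; rewrite eta_neq0 ?expf_neq0 //.
by rewrite (_ : [exists y, _] = true) //; apply/existsP; exists x.
Qed.

Lemma eta1 : eta (1 : F) = 1.
Proof. by rewrite -(expr1n F 2) eta_sqr ?oner_neq0. Qed.

Lemma eta_mul_sqr (x y : F) : y != 0 -> eta (x * y ^+ 2) = eta x.
Proof.
move=> y0; have [->|x0] := eqVneq x 0; first by rewrite mul0r.
rewrite !eta_neq0 ?mulf_neq0 ?expf_neq0 //.
suff -> : [exists z, x * y ^+ 2 == z ^+ 2] = [exists z, x == z ^+ 2] by [].
apply/existsP/existsP => -[z /eqP zE].
  exists (z / y); rewrite expr_div_n -zE mulfK ?expf_neq0 //.
by exists (z * y); rewrite exprMn zE.
Qed.

Lemma card_sqr_fiber (u : F) : #|[set x : F | x ^+ 2 == u]|%:R = 1 + eta u.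
Proof.
have [->|u0] := eqVneq u 0.
  rewrite eta0; suff -> : [set x : F | x ^+ 2 == 0] = [set 0] by rewrite cards1.
  by apply/setP => x; rewrite !inE expf_eq0.
rewrite eta_neq0 //; case: existsP => [[y /eqP uE]|nex]; last first.
  rewrite subrr; suff -> : [set x : F | x ^+ 2 == u] = set0 by rewrite cards0.
  apply/setP => x; rewrite !inE; apply/negP => /eqP xu; apply: nex.
  by exists x; rewrite xu.
suff -> : [set x : F | x ^+ 2 == u] = [set y; - y].
  rewrite cards2 (_ : y != - y) // -addr_eq0 -mulr2n -[y *+ 2]mulr_natr.
  by rewrite mulf_neq0 // (contraNneq _ u0) // uE => ->; rewrite expr0n.
by apply/setP => x; rewrite !inE uE eqf_sqr.
Qed.

(** Grouping the [x] by their square, [u] is hit [1 + eta u] times. This turns a quadratic argument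
    into a linear one at the price of a weight. *)
Lemma sum_over_squares (f : F -> int) :
  \sum_x f (x ^+ 2) = \sum_u (1 + eta u) * f u.
Proof.
rewrite (partition_big (fun x : F => x ^+ 2) xpredT) //=.
apply: eq_bigr => u _; rewrite -card_sqr_fiber.
rewrite (eq_bigr (fun=> f u)) => [|x /eqP -> //].
rewrite sumr_const mulr_natl; congr (_ *+ _).
by rewrite cardsE.
Qed.

(** For [f] constant 1 in [sum_over_squares], both sides count the field, and the surplus on the
    right is this sum. *)
Lemma sum_eta : \sum_(u : F) eta u = 0.
Proof.
have := sum_over_squares (fun=> 1).
under [in RHS]eq_bigr do rewrite mulr1.
rewrite big_split => /eqP.
by rewrite -subr_eq0 opprD addrA subrr sub0r oppr_eq0 => /eqP.
Qed.

(* Once a is a nonsquare, all terms of \sum_x (eta (a x) + eta x) = 0 have the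
   same sign. *)
Lemma etaM (x y : F) : eta (x * y) = eta x * eta y.
Proof.
have [->|x0] := eqVneq x 0; first by rewrite mul0r eta0 mul0r.
rewrite [eta x]eta_neq0 //; case: existsP => [[z /eqP xE]|nx].
  rewrite mul1r mulrC xE eta_mul_sqr //.
  by apply: contraNneq x0; rewrite xE => ->; rewrite expr0n.
have etaax z : - eta (x * z) - eta z >= 0.
  have [->|z0] := eqVneq z 0; first by rewrite mulr0 eta0.
  rewrite (eta_neq0 z0); case: existsP => [[t /eqP zE]|_].
    rewrite zE eta_mul_sqr; last first.
      by apply: contraNneq z0; rewrite zE => ->; rewrite expr0n.
    by rewrite eta_neq0 //; case: existsP.
  by rewrite eta_neq0 ?mulf_neq0 //; case: ifP.
have sum0 : \sum_z (- eta (x * z) - eta z) = 0.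
  rewrite sumrB sumrN sum_eta subr0; apply/eqP; rewrite oppr_eq0; apply/eqP.
  by rewrite -[RHS]sum_eta [RHS](reindex_inj (mulfI x0)).
move/eqP: sum0; rewrite psumr_eq0 // => /allP /(_ y).
rewrite mem_index_enum => /(_ isT) /=; lia.
Qed.

Lemma eta_exp (x : F) n : eta (x ^+ n) = eta x ^+ n.
Proof.
elim: n => [|n IHn]; last by rewrite !exprS etaM IHn.
by rewrite !expr0 eta1.
Qed.

Definition nu (t : F) : int := q * (t == 0)%:R - 1.

Lemma nu_sum : \sum_t nu t = 0.
Proof.
rewrite sumrB -mulr_sumr (bigD1 0) //= eqxx big1 ?addr0 ?mulr1; last first.
  by move=> t /negPf ->.
by rewrite sumr_const subrr.
Qed.

Lemma nu_sum_affine (a c : F) : a != 0 -> \sum_t nu (c + a * t) = 0.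
Proof.
move=> a0; rewrite -[RHS]nu_sum [RHS](reindex (fun t => c + a * t)) //=.
exists (fun s => (s - c) / a) => t _; first by rewrite addrAC subrr add0r mulrC mulKf.
by rewrite mulrC divfK // addrC subrK.
Qed.

Lemma nuZ (a t : F) : a != 0 -> nu (a * t) = nu t.
Proof. by move=> a0; rewrite /nu mulf_eq0 (negPf a0). Qed.

(** The value [nu (a * x ^+ 2)] depends only on whether [x] vanishes, so it equals [nu x]. This is
    the source of the zero in odd rank. *)
Lemma nu_sum_sqr (a : F) : a != 0 -> \sum_x nu (a * x ^+ 2) = 0.
Proof.
move=> a0; rewrite -[RHS]nu_sum; apply: eq_bigr => x _.
by rewrite nuZ // /nu expf_eq0.
Qed.

(** A Jacobi sum. If [c = 0], each of the [q - 1] nonzero [u] contributes [eta (-1)]. Otherwise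
    dividing by [u ^+ 2] leaves [eta (- c / u - 1)], whose argument takes every value except -1
    exactly once, and [sum_eta] applies. *)
Lemma sum_eta_prod (c : F) : \sum_u eta (u * (- c - u)) = eta (-1 : F) * nu c.
Proof.
have [->|c0] := eqVneq c 0.
  rewrite oppr0 /nu eqxx mulr1 (bigD1 0) //= mul0r eta0 add0r.
  rewrite (eq_bigr (fun=> eta (-1 : F))) => [|u u0]; last first.
    by rewrite sub0r -(eta_mul_sqr (-1) u0); congr eta; ring.
  have /prednK q_gt0 : (0 < #|F|)%N by apply/card_gt0P; exists 0.
  by rewrite sumr_const cardC1 -q_gt0 -[in RHS]natr1 addrK mulr_natr.
rewrite /nu (negPf c0) mulr0 sub0r mulrN1.
rewrite (bigD1 0) //= mul0r eta0 add0r.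
rewrite (eq_bigr (fun u => eta (- c / u - 1))) => [|u u0]; last first.
  rewrite -(eta_mul_sqr (- c / u - 1) u0); congr eta; field; exact: u0.
apply/eqP; rewrite -addr_eq0 addrC; apply/eqP.
rewrite -[RHS]sum_eta [RHS](bigD1 (-1 : F)) //=; congr (_ + _).
rewrite [RHS](reindex (fun u => - c / u - 1)) /=.
  apply: eq_bigl => u; rewrite -[_ == -1]subr_eq0 opprK subrK.
  by rewrite mulf_eq0 oppr_eq0 (negPf c0) invr_eq0.
exists (fun s => - c / (s + 1)) => u; rewrite !inE.
  rewrite -[_ == -1]subr_eq0 opprK !subrK mulf_eq0 oppr_eq0 (negPf c0) invr_eq0 /= => u0.
  by field; rewrite ?oppr_eq0 ?u0 ?c0.
rewrite -[_ == -1]subr_eq0 opprK => u0; field.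
by rewrite ?oppr_eq0 ?u0 ?c0.
Qed.

(** Both squares are made linear by [sum_over_squares]. The sum over the second variable collapses
    to one value of [eta], and the remaining sum over the first is a Jacobi sum. The result is again
    a multiple of [nu c], so two variables at a time can be removed from a diagonal form. *)
Lemma nu_sum_binary (a b c : F) : a != 0 -> b != 0 ->
  \sum_x \sum_y nu (c + a * x ^+ 2 + b * y ^+ 2) = q * eta (- (a * b)) * nu c.
Proof.
move=> a0 b0.
rewrite (eq_bigr (fun x => \sum_v (1 + eta v) * nu (c + a * x ^+ 2 + b * v))); last first.
  by move=> x _; rewrite -(sum_over_squares (fun v => nu (c + a * x ^+ 2 + b * v))).
rewrite (sum_over_squares (fun u => \sum_v (1 + eta v) * nu (c + a * u + b * v))).
(* The unweighted half vanishes by [nu_sum_affine]. In the half weighted by [eta v], the constant -1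
   of [nu] drops out by [sum_eta], and only the root [v] of the affine argument survives. *)
have inner u : \sum_v (1 + eta v) * nu (c + a * u + b * v) =
    q * eta ((- c - a * u) / b).
  under eq_bigr do rewrite mulrDl mul1r.
  rewrite big_split /= nu_sum_affine // add0r /nu.
  under eq_bigr do rewrite mulrBr mulr1.
  rewrite sumrB sum_eta subr0 (bigD1 ((- c - a * u) / b)) //=.
  rewrite mulrCA [in X in X + _]mulrC.
  rewrite [b * _]mulrC divfK // (_ : c + a * u + _ = 0); last by ring.
  rewrite eqxx mulr1n mulr1 mulrC big1 ?addr0 // => v /negPf vn.
  suff -> : (c + a * u + b * v == 0) = false by rewrite !mulr0.
  apply/negbTE; apply: contraFN vn => /eqP h; apply/eqP.
  by apply: (mulIf b0); rewrite divfK // mulrC -[b * v]subr0 -h; ring.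
under eq_bigr do rewrite inner mulrCA mulrDl mul1r.
rewrite -mulr_sumr -mulrA; congr (_ * _).
rewrite big_split /= [X in X + _](_ : _ = 0) ?add0r; last first.
  rewrite -[RHS]sum_eta [RHS](reindex (fun u => (- c - a * u) / b)) //=.
  exists (fun s => - (b * s + c) / a) => u _; field; exact/andP.
rewrite -[- (a * b)]mulN1r etaM mulrAC -sum_eta_prod mulr_suml.
rewrite [RHS](reindex_inj (mulfI a0)) /=; apply: eq_bigr => u _.
(* Multiplying by the square of [a * b] clears the denominator [b] and matches the substitution of
   [a * u] for [u]. *)
rewrite -!etaM -[LHS](eta_mul_sqr _ (mulf_neq0 a0 b0)).
by congr eta; field.
Qed.
End QuadraticCharacter.

(** * Sums over quadratic forms *)

Lemma det_mx22 (R : comNzRingType) (M : 'M[R]_2) :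
  \det M = M 0 0 * M 1 1 - M 0 1 * M 1 0.
Proof.
rewrite (expand_det_row _ 0) !big_ord_recl big_ord0 /cofactor !det_mx11 !mxE /=.
rewrite addr0 mul1r mulN1r mulrN; congr (_ * M _ _ - M _ _ * M _ _); exact/val_inj.
Qed.

(** * Schur complements of block matrices *)

Section Schur.
Variable R : comUnitRingType.

Definition schur_compl m n (A : 'M[R]_(m + n)) : 'M[R]_n :=
  drsubmx A - dlsubmx A *m invmx (ulsubmx A) *m ursubmx A.

Definition schur_elim m n (A : 'M[R]_(m + n)) : 'M[R]_(m + n) :=
  block_mx 1%:M 0 (- (dlsubmx A *m invmx (ulsubmx A))) 1%:M.

Lemma schur_elim_unit m n (A : 'M[R]_(m + n)) : schur_elim A \in unitmx.
Proof. by rewrite unitmxE det_lblock !det1 mulr1 unitr1. Qed.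

Lemma mul_schur_elim m n (A : 'M[R]_(m + n)) : ulsubmx A \in unitmx ->
  schur_elim A *m A = block_mx (ulsubmx A) (ursubmx A) 0 (schur_compl A).
Proof.
move=> uA; rewrite -[in LHS](submxK A) /schur_elim mulmx_block.
rewrite !block_mxKul !block_mxKdl !mul1mx !mul0mx !addr0.
rewrite !mulNmx mulmxKV // addNr.
by rewrite addrC.
Qed.

Lemma det_schur m n (A : 'M[R]_(m + n)) : ulsubmx A \in unitmx ->
  \det A = \det (ulsubmx A) * \det (schur_compl A).
Proof.
move=> uA; rewrite -(det_ublock _ (ursubmx A)) -mul_schur_elim //.
by rewrite det_mulmx det_lblock !det1 !mul1r.
Qed.

Lemma schur_congr m n (A : 'M[R]_(m + n)) :
  A^T = A -> ulsubmx A \in unitmx ->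
  schur_elim A *m A *m (schur_elim A)^T =
    block_mx (ulsubmx A) 0 0 (schur_compl A).
Proof.
move=> symA uA; have symul : (ulsubmx A)^T = ulsubmx A by rewrite trmx_ulsub symA.
have symur : (dlsubmx A)^T = ursubmx A by rewrite trmx_dlsub symA.
rewrite mul_schur_elim // /schur_elim tr_block_mx !trmx1 trmx0 linearN /=.
rewrite trmx_mul trmx_inv symul symur mulmx_block.
rewrite !mulmx0 !mulmx1 !mul0mx !add0r !addr0.
by rewrite mulmxN mulKVmx // addNr.
Qed.

Lemma schur_compl_sym m n (A : 'M[R]_(m + n)) :
  A^T = A -> (schur_compl A)^T = schur_compl A.
Proof.
move=> symA; have symul : (ulsubmx A)^T = ulsubmx A by rewrite trmx_ulsub symA.
have symur : (dlsubmx A)^T = ursubmx A by rewrite trmx_dlsub symA.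
have symdl : (ursubmx A)^T = dlsubmx A by rewrite trmx_ursub symA.
rewrite /schur_compl linearB /= trmx_drsub symA !trmx_mul trmx_inv.
by rewrite symul symur symdl mulmxA.
Qed.
End Schur.

(** * Diagonalising symmetric matrices and evaluating their [nu]-sums *)

Section QuadraticForm.
Variable F : finFieldType.
Hypothesis two_neq0 : 2%:R != 0 :> F.
Local Notation q := (#|F|%:R : int).

Definition qform n (A : 'M[F]_n) (x : 'rV_n) : F := (x *m A *m x^T) 0 0.

(** The offset [c] allows peeling off variables: those already fixed contribute a constant to the
    argument. *)
Definition nu_qsum n (A : 'M[F]_n) (c : F) : int := \sum_x nu (c + qform A x).

Lemma nu_qsum_congr n (P A : 'M[F]_n) c :
  P \in unitmx -> nu_qsum (P *m A *m P^T) c = nu_qsum A c.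
Proof.
move=> uP; rewrite /nu_qsum [RHS](reindex (mulmxr P)) /=.
  by apply: eq_bigr => x _; rewrite /qform trmx_mul !mulmxA.
by exists (mulmxr (invmx P)) => x _; rewrite /= ?mulmxK ?mulmxKV.
Qed.

Lemma sum_row_mx (V : nmodType) m n (f : 'rV[F]_(m + n) -> V) :
  \sum_x f x = \sum_y \sum_z f (row_mx y z).
Proof.
rewrite pair_big (reindex (fun p : 'rV[F]_m * 'rV[F]_n => row_mx p.1 p.2)) //=.
exists (fun x => (lsubmx x, rsubmx x)) => [[y z] _|x _] /=.
  by rewrite row_mxKl row_mxKr.
by rewrite hsubmxK.
Qed.

Lemma nu_qsum_block m n (A : 'M[F]_m) (D : 'M[F]_n) c :
  nu_qsum (block_mx A 0 0 D) c = \sum_y nu_qsum D (c + qform A y).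
Proof.
rewrite /nu_qsum sum_row_mx; apply: eq_bigr => y _; apply: eq_bigr => z _.
congr nu; rewrite -addrA; congr (_ + _).
rewrite /qform mul_row_block !mulmx0 add0r addr0 tr_row_mx mul_row_col.
by rewrite mxE.
Qed.

Lemma sum_rV1 (V : nmodType) (f : 'rV[F]_1 -> V) : \sum_x f x = \sum_t f t%:M.
Proof.
rewrite (reindex (fun t : F => t%:M)) //; exists (fun x : 'M[F]_1 => x 0 0) => x _.
  by rewrite mxE.
by rewrite -mx11_scalar.
Qed.

(** A nonzero diagonal entry is moved to the corner by a transposition. If the diagonal is zero,
    adding row and column [j] to row and column [i] first creates the diagonal entry [2 * A i j],
    nonzero since 2 is. *)
Lemma sym_pivot n (A : 'M[F]_(1 + n)) : A^T = A -> A != 0 ->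
  exists2 P, P \in unitmx & (P *m A *m P^T) 0 0 != 0.
Proof.
move=> symA A0.
have Aij i j : A i j = A j i by rewrite -[in LHS]symA mxE.
have swap i (B : 'M[F]_(1 + n)) : B i i != 0 ->
    exists2 P, P \in unitmx & (P *m B *m P^T) 0 0 != 0.
  move=> Bi; exists (tperm_mx 0 i); first exact: unitmx_perm.
  rewrite /tperm_mx tr_perm_mx -row_permE -col_permE.
  by rewrite !mxE tpermL.
have [/existsP[i]|/existsPn diag0] := boolP [exists i, A i i != 0]; first exact: swap.
have {}diag0 i : A i i = 0 by apply/eqP; move: (diag0 i); rewrite negbK.
have [i [j Aij0]] : exists i j, A i j != 0.
  exact/matrix0Pn.
have nij : i != j by apply: contraNneq Aij0 => <-; rewrite diag0.
pose P := 1%:M + delta_mx i j : 'M[F]_(1 + n).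
(* Because of this the inverse of [P] is [1%:M - delta_mx i j]. *)
have dd : delta_mx i j *m delta_mx i j = 0 :> 'M[F]_(1 + n).
  by rewrite mul_delta_mx_cond eq_sym (negPf nij).
have uP : P \in unitmx.
  suff /mulmx1_unit[] : P *m (1%:M - delta_mx i j) = 1%:M by [].
  by rewrite mulmxDl mulmxBr mulmxBr !mul1mx !mulmx1 dd subr0 subrK.
have PE : (P *m A *m P^T) i i = 2%:R * A i j.
  have PB (B : 'M[F]_(1 + n)) k : (P *m B) i k = B i k + B j k.
    rewrite /P mulmxDl mul1mx mxE; congr (_ + _).
    rewrite mxE (bigD1 j) //= big1 ?addr0 => [|l /negPf lj]; first
      by rewrite mxE !eqxx mul1r.
    by rewrite mxE lj andbF mul0r.
  have BP (B : 'M[F]_(1 + n)) k : (B *m P^T) k i = B k i + B k j.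
    by rewrite -[B *m _]trmxK mxE trmx_mul trmxK PB !mxE.
  rewrite BP !PB !diag0 [A j i]Aij; ring.
have [|Q uQ QE] := swap i (P *m A *m P^T); first by rewrite PE mulf_neq0.
exists (Q *m P); first by rewrite unitmx_mul uQ.
by rewrite trmx_mul -!mulmxA; move: QE; rewrite -!mulmxA.
Qed.

(** This is [nu_qsum] of the diagonal matrix with entries [s], as an iterated sum so that
    coefficients can be removed from the front of the list. *)
Fixpoint diag_nu_qsum (s : seq F) (c : F) : int :=
  if s is a :: s' then \sum_x diag_nu_qsum s' (c + a * x ^+ 2) else nu c.

Lemma diag_nu_qsum_even (s : seq F) c : all (predC1 0) s -> ~~ odd (size s) ->
  diag_nu_qsum s c =
  q ^+ (size s)./2 * eta ((-1) ^+ (size s)./2 * \prod_(a <- s) a) * nu c.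
Proof.
(* Strong induction on the length, since [nu_sum_binary] consumes two coefficients at once. *)
have [k] := ubnP (size s); elim: k s c => // k IHk [|a [|b s]] c //=.
  by rewrite big_nil mulr1 !expr0 eta1 !mul1r.
rewrite !negbK ltnS => /ltnW ltk /and3P[a0 b0 s0] sz.
under eq_bigr do under eq_bigr do rewrite IHk //.
under eq_bigr do rewrite -mulr_sumr.
rewrite -mulr_sumr nu_sum_binary // !big_cons !exprS.
rewrite (_ : _ * (a * _) = - (a * b) * ((-1) ^+ (size s)./2 * \prod_(j <- s) j)).
  by rewrite [in RHS]etaM //; ring.
ring.
Qed.

(** Summing all variables but the first by the even case leaves a multiple of [nu_sum_sqr]. The
    offset must be 0 here: for other offsets the sum need not vanish. *)
Lemma diag_nu_qsum_odd (s : seq F) : all (predC1 0) s -> odd (size s) ->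
  diag_nu_qsum s 0 = 0.
Proof.
case: s => //= a s /andP[a0 s0] sz.
under eq_bigr do rewrite diag_nu_qsum_even // add0r.
by rewrite -mulr_sumr nu_sum_sqr // mulr0.
Qed.

(** A congruence brings a nonzero pivot to the corner, block elimination splits it off, and the
    induction goes on with the Schur complement. Congruence by [P] multiplies the determinant by the
    square of [\det P], so only its quadratic character is tracked. *)
Lemma sym_diagonalize n (A : 'M[F]_n) : A^T = A -> A \in unitmx ->
  exists s : seq F, [/\ size s = n, all (predC1 0) s,
    (forall c, nu_qsum A c = diag_nu_qsum s c)
    & eta (\det A) = eta (\prod_(a <- s) a)].
Proof.
elim: n A => [|n IHn] A symA uA.
  exists [::]; split=> // [c|]; last by rewrite det_mx00 big_nil.
  rewrite /nu_qsum (big_pred1 0) => [|x]; last by rewrite [x]thinmx0 /= eqxx.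
  by rewrite /qform mul0mx mul0mx mxE addr0.
have A0 : A != 0.
  by apply: contraTneq uA => ->; rewrite unitmxE det0 unitr0.
have [P uP P00] := sym_pivot symA A0.
pose B : 'M[F]_(1 + n) := P *m A *m P^T.
have symB : B^T = B by rewrite /B !trmx_mul trmxK symA mulmxA.
have uB : B \in unitmx by rewrite !unitmx_mul uP uA unitmx_tr.
pose a := B 0 0.
have ulB : ulsubmx B = a%:M.
  rewrite [LHS]mx11_scalar /a; move: (B) => X.
  by rewrite !mxE; congr (X _ _)%:M; apply/val_inj.
have uul : ulsubmx B \in unitmx by rewrite ulB unitmxE det_scalar1 unitfE.
have := det_schur uul; set D := schur_compl B => detB.
have uD : D \in unitmx.
  by move: uB; rewrite !unitmxE detB unitrM => /andP[].
have [s [sz s0 sE etaD]] := IHn D (schur_compl_sym symB) uD.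
exists (a :: s); split=> /=; rewrite ?sz ?P00 //.
  move=> c; rewrite -(nu_qsum_congr _ _ uP) -/B.
  rewrite -(nu_qsum_congr _ _ (schur_elim_unit B)) schur_congr //.
  rewrite nu_qsum_block sum_rV1; apply: eq_bigr => t _.
  rewrite sE ulB; congr diag_nu_qsum; congr (_ + _).
  by rewrite /qform -!scalar_mxM tr_scalar_mx -scalar_mxM mxE mulr1n expr2; ring.
rewrite big_cons etaM // -etaD -etaM //.
have detP : \det P != 0 by rewrite -unitfE -unitmxE.
move: detB; rewrite ulB det_scalar1 => <-.
rewrite /B !det_mulmx det_tr -(eta_mul_sqr (\det A) detP); congr eta; ring.
Qed.

Lemma nu_qsum_unit n (A : 'M[F]_n) : A^T = A -> A \in unitmx ->
  nu_qsum A 0 = if odd n then 0 else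
    (q - 1) * q ^+ n./2 * eta (-1 : F) ^+ n./2 * eta (\det A).
Proof.
move=> symA uA; have [s [sz s0 -> ->]] := sym_diagonalize symA uA.
rewrite -{n A symA uA}sz; case: ifP => [sz|/negbT sz]; first exact: diag_nu_qsum_odd.
rewrite diag_nu_qsum_even // /nu eqxx mulr1 etaM // eta_exp //; ring.
Qed.

(* The 1 x 1 and 2 x 2 principal minors of the complement, which is symmetric,
   already force it to vanish. *)
Lemma schur_compl_eq0 m n (A : 'M[F]_(m + n)) :
  A^T = A -> ulsubmx A \in unitmx ->
  (forall k (t : 'I_k -> 'I_n), (0 < k)%N -> injective t ->
    \det (block_mx (ulsubmx A) (colsub t (ursubmx A))
       (rowsub t (dlsubmx A)) (mxsub t t (drsubmx A))) = 0) ->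
  schur_compl A = 0.
Proof.
move=> symA uA minors.
(* By [det_schur], the bordered minor of the hypothesis is the nonzero determinant of the upper left
   block times this minor of the complement. *)
have detM k (t : 'I_k -> 'I_n) : (0 < k)%N -> injective t ->
    \det (mxsub t t (schur_compl A)) = 0.
  move=> k0 injt; have := minors k t k0 injt; set A' := block_mx _ _ _ _.
  have uA' : ulsubmx A' \in unitmx by rewrite block_mxKul.
  rewrite det_schur // block_mxKul => /eqP; rewrite mulf_eq0.
  rewrite -[_ == 0]negbK -unitfE -unitmxE uA /= => /eqP <-; congr (\det _).
  rewrite /schur_compl block_mxKdr block_mxKdl block_mxKul block_mxKur.
  apply/matrixP => i j; rewrite !mxE; congr (_ - _).
  by apply: eq_bigr => l _; rewrite !mxE; congr (_ * _); apply: eq_bigr => l' _;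
    rewrite !mxE.
set M := schur_compl A in detM *.
have symM i j : M i j = M j i by rewrite -[in LHS](schur_compl_sym symA : M^T = M) mxE.
clearbody M.
have diagM i : M i i = 0.
  have := detM 1 (fun=> i) isT; rewrite det_mx11 mxE; apply.
  by move=> x y _; rewrite !ord1.
apply/matrixP => i j; rewrite mxE.
have [->|nij] := eqVneq i j; first exact: diagM.
have := detM 2 (fun x => if x == 0 then i else j) isT.
rewrite det_mx22 !mxE /= !diagM mul0r sub0r [M j i]symM => h.
apply/eqP; rewrite -sqrf_eq0 expr2 -oppr_eq0 h //.
by move=> x y; rewrite -!val_eqE /=; case: x y => [[|[|//]] ?] [[|[|//]] ?] /= e;
  apply/val_inj => //;
  rewrite e eqxx in nij.
Qed.

(** After the congruence the form ignores the last [n] coordinates, and each of them contributes a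
    factor [q]. *)
Lemma nu_qsum_schur0 m n (A : 'M[F]_(m + n)) :
  A^T = A -> ulsubmx A \in unitmx -> schur_compl A = 0 ->
  nu_qsum A 0 = q ^+ n * nu_qsum (ulsubmx A) 0.
Proof.
move=> symA uA schur0.
rewrite -(nu_qsum_congr _ _ (schur_elim_unit A)) schur_congr // schur0.
rewrite nu_qsum_block /nu_qsum mulr_sumr; apply: eq_bigr => y _.
rewrite (eq_bigr (fun=> nu (0 + qform (ulsubmx A) y))) => [|z _]; last first.
  by rewrite {2}/qform mulmx0 mul0mx mxE addr0.
by rewrite sumr_const card_mx mul1n -natrX mulr_natl.
Qed.
End QuadraticForm.

(** * Spanning trees and parent maps *)

Section Determinants.
Variable R : idomainType.

(** Multilinearity in the rows. For a Laplacian minor, [f] chooses one edge for each row. *)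
Lemma det_sum_rows n (E : finType) (c : 'I_n -> E -> R) (M : 'I_n -> E -> 'I_n -> R) :
  \det (\matrix_(i, j) \sum_e c i e * M i e j) =
  \sum_(f : {ffun 'I_n -> E})
     (\prod_i c i (f i)) * \det (\matrix_(i, j) M i (f i) j).
Proof.
under [RHS]eq_bigr do rewrite /determinant mulr_sumr.
rewrite exchange_big /=; apply: eq_bigr => s _.
under eq_bigr do rewrite mxE.
rewrite bigA_distr_bigA mulr_sumr; apply: eq_bigr => f _.
rewrite big_split /= mulrCA; congr (_ * (_ * _)).
by apply: eq_bigr => i _; rewrite mxE.
Qed.

Lemma det_kernel_eq0 n (M : 'M[R]_n) (v : 'cV[R]_n) i :
  M *m v = 0 -> v i 0 = 1 -> \det M = 0.
Proof.
move=> Mv vi; have : (\adj M *m (M *m v)) i 0 = 0 by rewrite Mv mulmx0 mxE.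
by rewrite mulmxA mul_adj_mx mul_scalar_mx mxE vi mulr1.
Qed.

(* det (1 - X N) is a unit of R[X], hence a constant, and its value at X = 0
   is 1. *)
Lemma det_sub1_nilpotent n (N : 'M[R]_n.+1) k : N ^+ k = 0 -> \det (1 - N) = 1.
Proof.
move=> Nk; pose XN : 'M[{poly R}]_n.+1 := 'X *: map_mx polyC N.
have XNk : XN ^+ k = 0.
  by rewrite exprZn -rmorphXn /= Nk rmorph0 scaler0.
have : \det (1 - XN) \is a GRing.unit.
  have : \det (1 - XN) * \det (\sum_(i < k) XN ^+ i) = 1.
    rewrite -det_mulmx -[RHS](det1 _ n.+1); congr (\det _).
    have := subrX1 XN k; rewrite XNk sub0r => /(congr1 -%R).
    by rewrite opprK -mulNr opprB => /esym.
  by move=> detM; apply/unitrP; exists (\det (\sum_(i < k) XN ^+ i)); rewrite mulrC detM.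
have ev x : (\det (1 - XN)).[x] = \det (1 - x *: N).
  rewrite -/(horner_eval x _) -det_map_mx; congr (\det _).
  by apply/matrixP => i j; rewrite !mxE /= /horner_eval !hornerE hornerMn !hornerE.
rewrite poly_unitE => /andP[/size_poly1P[c _ detE] _].
have := ev 1; have := ev 0; rewrite detE !hornerC scale0r subr0 scale1r => -> <-.
exact: det1.
Qed.
End Determinants.

(** * Walks, cycles and the ends of an edge *)

Section Walks.
Variable H : multigraph.
Implicit Types (T : {set edge H}) (c : seq (vertex H * edge H)).

Lemma acyclicP T : reflect (forall c, ~~ is_cycle T c) (acyclic T).
Proof.
apply: (iffP idP) => [/existsPn acT c|acT]; last first.
  by apply/existsPn => n; apply/existsPn => c.
apply/negP => cyc; have /and5P[_ uc _ _ _] := cyc.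
have sz : (size c < #|vertex H|.+1)%N.
  by rewrite ltnS -(size_map fst) -(card_uniqP uc) max_card.
have /existsPn /(_ (in_tuple c)) := acT (Ordinal sz).
by rewrite cyc.
Qed.

Lemma adj_by_sym T : symmetric (adj_by T).
Proof.
by move=> u v; apply/existsP/existsP => -[e]; rewrite setUC; exists e.
Qed.

(** Chooses an edge for each step of a simple path. The list [c] omits the last vertex: the final
    clause allows any pair [x] based there to be appended, in particular a closing edge. *)
Lemma uniq_path_edges T v p : path (adj_by T) v p -> uniq (v :: p) ->
  exists c, [/\ unzip1 c = belast v p, uniq (unzip2 c), all (fun a => a.2 \in T) c,
    (forall a, a \in c -> ends a.2 \subset v :: p)
  & forall x : vertex H * edge H, x.1 = last v p ->
     (head x (rcons c x)).1 = v /\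
     sorted (fun a b => ends a.2 == [set a.1; b.1]) (rcons c x)].
Proof.
elim: p v => [|w p IHp] v /=; first by exists [::]; split.
move=> /andP[/exists_inP[e eT /eqP eE] wp] /andP[vwp uwp].
have [c [c1 c2 cT cV cP]] := IHp w wp uwp.
exists ((v, e) :: c); split=> /=; rewrite ?c1 ?eT //.
(* The new edge has [v] as an end, whereas the later edges have both ends on [w :: p], which avoids
   [v]. *)
- rewrite c2 andbT; apply: contra vwp => /mapP[a ac ea].
  by apply: (subsetP (cV a ac)); rewrite -ea eE set21.
- move=> a; rewrite inE => /predU1P[-> /=|/cV /subset_trans]; last first.
    by apply; apply/subsetP => x xp; rewrite inE xp orbT.
  by rewrite eE; apply/subsetP => x; rewrite !inE => /orP[] ->; rewrite ?orbT.
- move=> x xE; split=> //; have [hd so] := cP x xE.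
  by move: hd so; rewrite headI /= => -> ->; rewrite eE eqxx.
Qed.

(** A simple path from [v] to [u] avoiding [e] would be closed into a cycle by [e]. *)
Lemma acyclic_closing_edge T e u v : acyclic T ->
  e \in T -> ends e = [set u; v] -> ~~ connect (adj_by (T :\ e)) v u.
Proof.
move=> /acyclicP acT eT eE; apply/negP => /connectP[p0 p0P].
case/shortenP: p0P => p pP up _ uE.
have [c [c1 c2 cT cV cP]] := uniq_path_edges pP up.
have [hd so] := cP (u, e) uE.
move/negP: (acT (rcons c (u, e))); apply; apply/and5P; split.
- by rewrite headI.
- by rewrite /unzip1 map_rcons -/unzip1 c1 /= uE -lastI.
- rewrite /unzip2 map_rcons -/unzip2 rcons_uniq c2 andbT.
  apply/negP => /mapP[a /(allP cT)] /=; rewrite !inE => /andP[ne _] /= ea.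
  by rewrite ea eqxx in ne.
- rewrite all_rcons /= eT /=; apply: sub_all cT => a.
  by rewrite inE => /andP[].
(* An empty path means [u = v]: then [e] is a loop and forms a cycle alone. *)
- case: {c1 c2 cT cV cP} c hd so => [|y c] /=; first by rewrite eE => ->; rewrite eqxx.
  by move=> hd so; rewrite [X in is_true X]rcons_path so last_rcons /= eE hd eqxx.
Qed.

(** The default [v] is returned only when [e] is a loop at [v]. *)
Definition other_end (e : edge H) (v : vertex H) : vertex H :=
  odflt v [pick w in ends e :\ v].

Hypothesis noloop : loopless H.

Lemma other_endP e v : v \in ends e ->
  other_end e v != v /\ ends e = [set v; other_end e v].
Proof.
move=> ve; have := noloop e; rewrite (cardsD1 v) ve => -[] /eqP/cards1P[w eD].
have wD : w \in ends e :\ v by rewrite eD set11.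
have -> : other_end e v = w.
  rewrite /other_end; case: pickP => [x|/(_ w)]; last by rewrite wD.
  by rewrite eD => /set1P.
split; first by move: wD; rewrite !inE => /andP[].
by rewrite -(setD1K ve) eD.
Qed.

Lemma other_end_mem e v : v \in ends e -> other_end e v \in ends e.
Proof. by case/other_endP => _ ->; rewrite set22. Qed.

Lemma other_end_unique e u v : u \in ends e -> v \in ends e -> u != v ->
  other_end e u = v.
Proof.
move=> ue ve nuv; have [_ eE] := other_endP ue.
by move: ve; rewrite eE !inE eq_sym (negPf nuv) => /eqP.
Qed.
End Walks.

(** * Spanning trees as parent pointers towards a root *)

Section RootedTrees.
Variables (H : multigraph) (n : nat) (h : 'I_n -> vertex H) (root : vertex H).
Hypothesis noloop : loopless H.
Hypothesis h_inj : injective h.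
Hypothesis codom_h : forall v, (v \in codom h) = (v != root).
Implicit Types (f : {ffun 'I_n -> edge H}) (T : {set edge H}).

(** The map [h] enumerates the non-root vertices, and [f] selects for each one the edge leading to
    its parent. The root is made a fixed point, so that reaching it is a statement about
    iterates. *)
Definition parent f (v : vertex H) : vertex H :=
  if [pick i | h i == v] is Some i then other_end (f i) v else root.

Definition parent_map f : bool :=
  [forall i, (h i \in ends (f i)) && fconnect (parent f) (h i) root].

Lemma vertex_cases v : v = root \/ exists i, v = h i.
Proof.
have [->|] := eqVneq v root; first by left.
by rewrite -codom_h => /codomP[i ->]; right; exists i.
Qed.

Lemma h_neq_root i : h i != root.
Proof. by rewrite -codom_h codom_f. Qed.

Lemma parent_h f i : parent f (h i) = other_end (f i) (h i).
Proof.
rewrite /parent; case: pickP => [j /eqP /h_inj -> //|/(_ i)].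
by rewrite eqxx.
Qed.

Lemma parent_root f : parent f root = root.
Proof.
rewrite /parent; case: pickP => // i /eqP hi.
by have := h_neq_root i; rewrite hi eqxx.
Qed.

(** The iterates of [v] stay in [D]. It serves for contradictions: a [parent]-stable set avoiding
    the root contains no vertex that reaches the root. *)
Lemma parent_closed_root f (D : pred (vertex H)) v :
  (forall u, D u -> D (parent f u)) -> D v -> fconnect (parent f) v root ->
  D root.
Proof.
move=> clD Dv /iter_findex <-.
by elim: (findex _ _ _) => //= k; apply: clD.
Qed.

Lemma parent_map_ends f i : parent_map f -> h i \in ends (f i).
Proof. by move/forallP/(_ i)/andP => []. Qed.

Lemma parent_map_connect f v : parent_map f -> fconnect (parent f) v root.
Proof.
move=> /forallP pf; have [->|[i ->]] := vertex_cases v; first exact: connect0.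
by have /andP[] := pf i.
Qed.

(** Two vertices sharing an edge are its two ends, hence parents of each other, and the pair is a
    stable set without the root. *)
Lemma parent_map_inj f : parent_map f -> injective f.
Proof.
move=> pf i j fij; apply: contraTeq isT => nij.
have hij : h i != h j by rewrite (inj_eq h_inj).
have hie := parent_map_ends i pf; have hje := parent_map_ends j pf.
have := parent_map_connect (h i) pf.
move/(@parent_closed_root f (pred2 (h i) (h j))) => /=.
rewrite eqxx ![_ root]/= ![root == _]eq_sym !(negPf (h_neq_root _)); apply=> //.
move=> u /orP[] /eqP ->; rewrite parent_h.
  have -> : other_end (f i) (h i) = h j by apply: other_end_unique; rewrite // fij.
  by rewrite eqxx orbT.
have -> : other_end (f j) (h j) = h i.
  by apply: other_end_unique; rewrite // -?fij // eq_sym.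
by rewrite eqxx.
Qed.

Lemma parent_map_connected f : parent_map f -> connected_by (f @: setT).
Proof.
move=> pf; apply/andP; split; first by apply/card_gt0P; exists root.
have toroot v : connect (adj_by (f @: setT)) v root.
  have := parent_map_connect v pf; apply: connect_sub => x y /eqP <-.
  have [->|[i ->]] := vertex_cases x; first by rewrite parent_root connect0.
  apply: connect1; apply/exists_inP; exists (f i); first exact: imset_f.
  rewrite parent_h; apply/eqP.
  by have [] := other_endP noloop (parent_map_ends i pf).
apply/forallP => u; apply/forallP => v; apply: connect_trans (toroot u) _.
by rewrite (sym_connect_sym (@adj_by_sym _ _)).
Qed.

(* A cycle has as many vertices as edges, and f maps injectively its non-root
   vertices to edges: so its vertex set avoids the root and is stable under
   parent. *)
Lemma parent_map_acyclic f : parent_map f -> acyclic (f @: setT).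
Proof.
move=> pf; apply/acyclicP => c; apply/negP => /and5P[c0 u1 u2 cT cyc].
have endsC a : a \in c -> ends a.2 \subset unzip1 c.
  move=> ac; have /eqP -> := next_cycle cyc ac.
  by apply/subsetP => x; rewrite !inE => /orP[] /eqP ->; apply: map_f; rewrite ?mem_next.
pose I := [set i | f i \in unzip2 c].
have inI i : (i \in I) = (f i \in unzip2 c) by rewrite inE.
have fI : f @: I = [set e in unzip2 c].
  apply/setP => e; rewrite inE; apply/imsetP/idP => [[i]|ec].
    by rewrite inE => ? ->.
  have /mapP[a ac eE] := ec; have /imsetP[i _ fi] := allP cT a ac.
  by exists i; rewrite ?inE -?fi -?eE.
have cardI : #|h @: I| = size c.
  rewrite card_imset // -(card_imset _ (parent_map_inj pf)) fI cardsE.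
  by rewrite (card_uniqP u2) size_map.
have hI : h @: I = [set v in unzip1 c].
  apply/eqP; rewrite eqEcard cardI cardsE (card_uniqP u1) size_map leqnn andbT.
  apply/subsetP => v /imsetP[i]; rewrite inI => /mapP[a ac fi] ->.
  by rewrite inE; apply: (subsetP (endsC a ac)); rewrite -fi parent_map_ends.
have [a ac] : exists a, a \in c by case: (c) c0 => // a s _; exists a; rewrite mem_head.
have := parent_map_connect a.1 pf.
move/(@parent_closed_root f (mem (h @: I))) => /=.
have rI : (root \in h @: I) = false.
  by apply/imsetP => -[i _ /eqP]; rewrite eq_sym (negPf (h_neq_root i)).
rewrite rI => root_in; suff clI : forall u, u \in h @: I -> parent f u \in h @: I.
  by have := root_in clI; rewrite hI inE map_f // => /(_ isT).
move=> u /imsetP[i]; rewrite inI => /mapP[b bc fi] ->; rewrite parent_h hI inE.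
by apply: (subsetP (endsC b bc)); rewrite -fi other_end_mem ?parent_map_ends.
Qed.

(* Two parent maps with the same edges differ on a parent-stable set of
   non-root vertices. *)
Lemma parent_map_imset_inj f g :
  parent_map f -> parent_map g -> f @: setT = g @: setT -> f = g.
Proof.
move=> pf pg fg; apply/ffunP => i; apply/eqP; apply: contraTT isT => nfg.
pose D := h @: [set i | f i != g i].
have := parent_map_connect (h i) pf.
move/(@parent_closed_root f (mem D)) => /=.
have -> : (root \in D) = false.
  by apply/imsetP => -[j _ /eqP]; rewrite eq_sym (negPf (h_neq_root j)).
apply; last by rewrite imset_f ?inE.
move=> _ /imsetP[j + ->]; rewrite inE parent_h => nj.
have /imsetP[k _ fj] : f j \in g @: setT by rewrite -fg imset_f.
have njk : j != k by apply: contraNneq nj => jk; rewrite fj jk.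
have hj := parent_map_ends j pf; have hk : h k \in ends (f j).
  by rewrite fj parent_map_ends.
rewrite (other_end_unique noloop hj hk) ?(inj_eq h_inj) // imset_f // inE.
by rewrite -fj (inj_eq (parent_map_inj pf)) eq_sym.
Qed.

(** Let [d] be the distance to the root inside [T]. The first edge of a shortest path leads to a
    vertex with smaller [d]; selecting such an edge at every non-root vertex gives pointers that
    descend to the root. *)
Lemma spanning_tree_parent_map T : spanning_tree T ->
  exists2 f, parent_map f & f @: setT = T.
Proof.
move=> /andP[/andP[_ conT] acT].
pose P v k := [exists p : k.-tuple (vertex H), path (adj_by T) v p && (last v p == root)].
have exP v : exists k, P v k.
  have /forallP/(_ v)/forallP/(_ root)/connectP[p pP rp] := conT.
  by exists (size p); apply/existsP; exists (in_tuple p); rewrite pP -rp eqxx.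
pose d v := ex_minn (exP v).
have dlt i : exists e, [&& e \in T, h i \in ends e & d (other_end e (h i)) < d (h i)]%N.
  rewrite {2}/d; case: ex_minnP => k /existsP[p /andP[]] + + _.
  case: p => [[|w p] /= /eqP <-]; first by rewrite (negPf (h_neq_root i)).
  move=> /andP[/exists_inP[e eT /eqP eE] wp] rp; exists e.
  have hie : h i \in ends e by rewrite eE set21.
  rewrite eT hie /=; have -> : other_end e (h i) = w.
    have [nw] := other_endP noloop hie; rewrite eE => /setP/(_ (other_end e (h i))).
    by rewrite !inE (negPf nw) eqxx /= => /eqP.
  rewrite /d ltnS; case: ex_minnP => l _; apply.
  by apply/existsP; exists (in_tuple p); rewrite wp rp.
have [f fP] := fin_all_exists dlt.
have pf : parent_map (finfun f).
  apply/forallP => i; rewrite ffunE; have /and3P[_ -> _] /= := fP i.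
  have [m] := ubnP (d (h i)); elim: m i => // m IHm i; rewrite ltnS => dm.
  apply: connect_trans (fconnect1 _ _) _.
  have [->|[j hj]] := vertex_cases (parent (finfun f) (h i)); first exact: connect0.
  rewrite hj; apply: IHm; rewrite -hj parent_h ffunE.
  by have /and3P[_ _ lt] := fP i; apply: leq_trans lt dm.
exists (finfun f) => //; apply/eqP; rewrite eqEsubset; apply/andP; split.
  by apply/subsetP => e /imsetP[i _ ->]; rewrite ffunE; have /and3P[] := fP i.
(* The image of [f] already connects all vertices, so an edge of [T] outside it would close a
   cycle. *)
apply/subsetP => e eT; rewrite -[_ \in _]negbK; apply/negP => ne.
have /cards2P[u [v [_ eE]]] : #|ends e| == 2%N by rewrite noloop.
move/negP: (acyclic_closing_edge acT eT eE); apply.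
have /andP[_ /forallP/(_ v)/forallP/(_ u)] := parent_map_connected pf.
apply: connect_sub => x y /exists_inP[e' e'f e'E]; apply: connect1.
apply/exists_inP; exists e' => //; rewrite !inE; apply/andP; split.
  by apply: contraNneq ne => <-.
by have /imsetP[i _ ->] := e'f; rewrite ffunE; have /and3P[] := fP i.
Qed.

(** Taking the image is a bijection from parent maps to spanning trees, and injectivity of [f] turns
    the product over tree edges into one over non-root vertices. *)
Lemma tree_sum_parent_maps (R : comNzRingType) (a : edge H -> R) :
  tree_sum a = \sum_(f | parent_map f) \prod_i a (f i).
Proof.
rewrite (partition_big (fun f : {ffun 'I_n -> edge H} => f @: setT)
  (fun T => spanning_tree T)) /=.
  apply: eq_bigr => T /spanning_tree_parent_map[f pf fT].
  rewrite (big_pred1 f) => [|g] /=.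
    rewrite -fT big_imset /= => [|x y _ _]; last exact: parent_map_inj.
    by apply: eq_bigl => i; rewrite inE.
  apply/andP/eqP => [[pg /eqP gT]|->]; last by rewrite fT eqxx.
  by apply: parent_map_imset_inj => //; rewrite gT.
by move=> f pf; rewrite /spanning_tree parent_map_connected ?parent_map_acyclic.
Qed.
End RootedTrees.

(** * The matrix-tree theorem *)

(** Powers are written as iterated products so that size 0 is covered too. *)
Lemma det_sub1_nilpotent_mx (R : idomainType) n (N : 'M[R]_n) k :
  iter k (mulmx N) 1%:M = 0 -> \det (1%:M - N) = 1.
Proof.
case: n N => [|n] N Nk; first by rewrite det_mx00.
apply: (@det_sub1_nilpotent _ _ _ k); rewrite -Nk.
by elim: k {Nk} => //= k <-; rewrite exprS.
Qed.

(** Contribution of a single edge of weight 1 to the Laplacian, without reference to an orientation.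
    On a loop it gives 1 instead of 0, so it is the usual coefficient for loopless multigraphs
    only. *)
Definition lap_coef (R : pzRingType) (H : multigraph) (e : edge H) (v w : vertex H) : R :=
  if v \in ends e then (if w == v then 1 else - (w \in ends e)%:R) else 0.

Definition laplacian (R : pzRingType) (H : multigraph) (a : edge H -> R)
  (v w : vertex H) : R := \sum_e a e * lap_coef R e v w.

Section MatrixTree.
Variables (R : idomainType) (H : multigraph).
Variables (n : nat) (h : 'I_n -> vertex H) (root : vertex H).
Hypothesis noloop : loopless H.
Hypothesis h_inj : injective h.
Hypothesis codom_h : forall v, (v \in codom h) = (v != root).

Lemma lap_coef_other (e : edge H) v w : v \in ends e ->
  lap_coef R e v w = (w == v)%:R - (w == other_end e v)%:R.
Proof.
move=> ve; rewrite /lap_coef ve; have [no eE] := other_endP noloop ve.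
have [->|nw] := eqVneq w v; first by rewrite eq_sym (negPf no) subr0.
by rewrite {1}eE !inE (negPf nw) sub0r.
Qed.

(** The sum skips the root, which is harmless as [x] vanishes there; hence [u] may be the root as
    well. *)
Lemma sum_delta_h (u : vertex H) (x : vertex H -> R) : x root = 0 ->
  \sum_j (h j == u)%:R * x (h j) = x u.
Proof.
move=> x0; have [->|[i ->]] := vertex_cases codom_h u.
  by rewrite x0 big1 // => j _; rewrite (negPf (h_neq_root codom_h j)) mul0r.
rewrite (bigD1 i) //= eqxx mul1r big1 ?addr0 // => j ji.
by rewrite (inj_eq h_inj) (negPf ji) mul0r.
Qed.

(* The matrix is 1 - N with N the matrix of the parent function: N is nilpotent
   if every vertex reaches the root, and otherwise the indicator of the vertices
   that do not reach it lies in the kernel. *)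
Lemma det_lap_coef (f : {ffun 'I_n -> edge H}) :
  \det (\matrix_(i, j) lap_coef R (f i) (h i) (h j)) = (parent_map h root f)%:R.
Proof.
(* If some [f i] does not meet [h i], row [i] is zero and [f] is not a parent map. *)
have [/forallP fe|/forallPn[i hi]] := boolP [forall i, h i \in ends (f i)]; last first.
  rewrite (expand_det_row _ i) big1 => [|j _]; last first.
    by rewrite mxE /lap_coef (negPf hi) mul0r.
  have -> // : parent_map h root f = false.
  by apply/forallP => /(_ i); rewrite (negPf hi).
pose N : 'M[R]_n := \matrix_(i, j) (h j == parent h root f (h i))%:R.
have -> : \matrix_(i, j) lap_coef R (f i) (h i) (h j) = 1%:M - N.
  apply/matrixP => i j; rewrite !mxE lap_coef_other // parent_h //.
  by rewrite (inj_eq h_inj) eq_sym.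
case: (boolP (parent_map h root f)) => [pf|/forallPn[i]].
  apply: (@det_sub1_nilpotent_mx _ _ _ #|vertex H|).
  have NE m i j : iter m (mulmx N) 1%:M i j =
      (h j == iter m (parent h root f) (h i))%:R.
    elim: m i => [|m IHm] i; first by rewrite mxE (inj_eq h_inj) eq_sym.
    rewrite [in RHS]iterSr [in LHS]iterS mxE.
    under eq_bigr do rewrite IHm mxE.
    rewrite (sum_delta_h _ (x := fun u => (h j == iter m (parent h root f) u)%:R)) //.
    by rewrite iter_fix ?parent_root // (negPf (h_neq_root codom_h j)).
  apply/matrixP => i j; rewrite NE mxE.
  suff -> : iter #|vertex H| (parent h root f) (h i) = root.
    by rewrite (negPf (h_neq_root codom_h j)).
  have hr := parent_map_connect codom_h (h i) pf.
  (* The root is reached in fewer than [#|vertex H|] steps and is fixed afterwards. *)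
  rewrite -(@subnK (findex (parent h root f) (h i) root) #|vertex H|); last first.
    by apply: leq_trans (max_card _); apply: ltnW; apply: findex_max.
  by rewrite iterD iter_findex // iter_fix // parent_root.
rewrite fe /= => ni.
pose D v : R := (~~ fconnect (parent h root f) v root)%:R.
apply: (@det_kernel_eq0 _ _ _ (\col_j D (h j)) i); last by rewrite mxE /D ni.
rewrite mulmxBl mul1mx; apply/colP => k; rewrite !mxE.
under eq_bigr do rewrite !mxE.
rewrite (sum_delta_h _ (x := D)); last by rewrite /D connect0.
apply/eqP; rewrite subr_eq0 /D; apply/eqP; congr (~~ _)%:R.
apply/idP/idP; last exact: connect_trans (fconnect1 _ _).
case/connectP => -[|v p] /=; first by move=> _ hk; have := h_neq_root codom_h k;
  rewrite hk eqxx.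
by move=> /andP[/eqP -> vp] rp; apply/connectP; exists p.
Qed.

(** Expanding along the rows yields one determinant per choice of edges, and it is 1 or 0 according
    to whether the choice is a parent map. *)
Theorem matrix_tree (a : edge H -> R) :
  \det (\matrix_(i, j) laplacian a (h i) (h j)) = tree_sum a.
Proof.
rewrite /laplacian (det_sum_rows (fun i e => a e) (fun i e j => lap_coef R e (h i) (h j))).
rewrite (tree_sum_parent_maps noloop h_inj codom_h) [RHS]big_mkcond.
apply: eq_bigr => f _; rewrite det_lap_coef.
by case: ifP; rewrite ?mulr1 ?mulr0.
Qed.
End MatrixTree.

(** * Contractions and principal minors of the Laplacian *)

Section ContractedLaplacian.
Variables (F : finFieldType) (G : multigraph).
Hypothesis noloop : loopless G.
Implicit Types (W : {set vertex G}) (alpha : {ffun edge G -> F}).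

Lemma contract_proj_eq_None W v : (contract_proj W v == None) = (v \in W).
Proof. by rewrite /contract_proj; case: insubP => [x|];
  [move=> /negPf -> |rewrite negbK => ->]. Qed.

Lemma contract_proj_eq W u v : v \notin W ->
  (contract_proj W u == contract_proj W v) = (u == v).
Proof.
move=> vW; apply/eqP/eqP => [|-> //].
rewrite /contract_proj (insubT (fun x => x \notin W) vW).
by case: insubP => // x _ <- [->].
Qed.

Lemma contract_ends_mem W (e : contract_edge W) v : v \notin W ->
  (contract_proj W v \in contract_ends e) = (v \in ends (val e)).
Proof.
move=> vW; apply/imsetP/idP => [[u ue /eqP]|ve]; last by exists v.
by rewrite eq_sym contract_proj_eq // => /eqP <-.
Qed.

Lemma contract_loopless W : loopless (contract W).
Proof.
move=> e; have := noloop (val e) => /eqP/cards2P[u [v [nuv eE]]].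
have : ~~ (ends (val e) \subset W) := valP e.
rewrite /= /contract_ends eE imsetU1 imset_set1 cards2 subUset !sub1set => nW.
rewrite (_ : _ != _) //; move: nW; rewrite negb_and => /orP[] nW.
  by rewrite eq_sym contract_proj_eq // eq_sym.
by rewrite contract_proj_eq.
Qed.

(** With nothing identified, [None] is an additional isolated vertex, so no spanning tree exists. *)
Lemma contract_tree_sum_set0 alpha : (0 < #|vertex G|)%N ->
  contract_tree_sum alpha set0 = 0.
Proof.
move=> /card_gt0P[v _]; apply: big1 => T /andP[/andP[_ conT] _].
have /forallP/(_ None)/forallP/(_ (contract_proj set0 v))/connectP[p] := conT.
case: p => [|w p] /=.
  by move=> _ /eqP; rewrite contract_proj_eq_None inE.
move=> /andP[/exists_inP[e _ /eqP eE] _] _.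
have : None \in contract_ends e by rewrite [contract_ends e]eE set21.
by move=> /imsetP[u _ /esym/eqP]; rewrite contract_proj_eq_None inE.
Qed.

(** The matrix-tree theorem for the contraction rooted at [None]. The deleted edges have both ends
    in [W] and contribute nothing to rows outside [W]. *)
Lemma contract_tree_sum_det alpha W n (h : 'I_n -> vertex G) :
  injective h -> codom h =i ~: W ->
  contract_tree_sum alpha W = \det (\matrix_(i, j) laplacian alpha (h i) (h j)).
Proof.
move=> h_inj hW; have nW i : h i \notin W by rewrite -in_setC -hW codom_f.
pose h' i : vertex (contract W) := contract_proj W (h i).
rewrite /contract_tree_sum -(@matrix_tree _ _ _ h' None).
- congr (\det _); apply/matrixP => i j; rewrite !mxE /laplacian.
  rewrite [RHS](bigID (fun e => ~~ (ends e \subset W))) /= [X in _ + X]big1 ?addr0.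
    rewrite (eq_bigl (mem [pred e | ~~ (ends e \subset W)])) // [RHS]big_sub.
    apply: eq_bigr => e _; rewrite /contract_weight /lap_coef.
    by rewrite !contract_ends_mem // contract_proj_eq.
  move=> e; rewrite negbK => /subsetP eW.
  by rewrite /lap_coef (contraNF (eW (h i))) ?mulr0.
- exact: contract_loopless.
- by move=> i j /eqP; rewrite contract_proj_eq // (inj_eq h_inj) => /eqP.
- case=> [[v vW]|].
    apply/codomP; have /codomP[i hi] : v \in codom h by rewrite hW inE.
    exists i; rewrite /h' /contract_proj -hi.
    by rewrite (insubT (fun x => x \notin W) vW).
  by apply/negbTE/codomP => -[i /esym/eqP]; rewrite contract_proj_eq_None (negPf (nW i)).
Qed.
End ContractedLaplacian.

(** * Gauss sums and flows *)

Section EtaMinusOne.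
Variable F : finFieldType.
Hypothesis oddF : odd #|F|.

Lemma two_neq0_of_odd_card : 2%:R != 0 :> F.
Proof.
apply/negP => two0; have F2 : 2%N \in [pchar F] by rewrite inE.
have := oddF; rewrite (card_pprimeChar F2) oddX orbF => /eqP n0.
by have := finNzRing_gt1 F; rewrite (card_pprimeChar F2) n0.
Qed.

(** If -1 is the square of [y] and [#|F|] is 3 modulo 4, then [y ^+ #|F| = y] reads [- y = y]. If
    [#|F| = 4k + 1] and -1 is no square, then [y ^+ (2 * k)] is a square root of 1 other than -1 for
    all nonzero [y], giving a polynomial of degree [2k] with [4k] roots. *)
Lemma eta_opp1 : eta (-1 : F) = if (#|F| %% 4 == 1)%N then 1 else -1.
Proof.
have two := two_neq0_of_odd_card.
have q_gt1 := finNzRing_gt1 F.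
rewrite eta_neq0 ?oppr_eq0 ?oner_neq0 //.
suff -> : [exists y : F, -1 == y ^+ 2] = (#|F| %% 4 == 1)%N by [].
have qE := divn_eq #|F| 4; set k := (#|F| %/ 4)%N in qE; clearbody k.
apply/existsP/idP => [[y /eqP yE]|/eqP q1].
  have y0 : y != 0.
    by apply/eqP => y0; move/eqP: yE; rewrite y0 expr0n oppr_eq0 oner_eq0.
  apply: contraTT isT => q1; have q3 : (#|F| %% 4 = 3)%N.
    by move: oddF q1 (ltn_pmod #|F| (isT : 0 < 4)%N); lia.
  have := expf_card y; rewrite qE q3 exprD mulnC (exprM _ 4) (exprM _ 2 2) -yE.
  rewrite sqrrN !expr1n mul1r exprS -yE mulrN1 => /eqP.
  by rewrite eq_sym -addr_eq0 -mulr2n -[_ *+ 2]mulr_natr mulf_eq0 (negPf y0) (negPf two).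
apply/existsP; apply: contraT => /existsPn ny.
have k_gt0 : (0 < k)%N by move: q_gt1; rewrite qE q1; case: (k).
have roots (y : F) : y != 0 -> y ^+ (2 * k) = 1.
  move=> y0; have /eqP : (y ^+ (2 * k)) ^+ 2 = 1 ^+ 2.
    rewrite -exprM expr1n; apply: (mulfI y0); rewrite mulr1 -exprS.
    by rewrite -[RHS]expf_card qE q1; congr (_ ^+ _); lia.
  rewrite eqf_sqr => /orP[/eqP -> //|/eqP ym1].
  by have := ny (y ^+ k); rewrite -exprM mulnC ym1 eqxx.
have Xk : ('X^(2 * k) - 1 : {poly F}) != 0.
  by rewrite -size_poly_gt0 size_XnsubC // muln_gt0.
have := max_poly_roots (rs := enum (predC1 (0 : F))) Xk.
rewrite enum_uniq -[size (enum _)]cardE size_XnsubC ?muln_gt0 // cardC1 qE q1.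
have -> : all (root ('X^(2 * k) - 1)) (enum (predC1 (0 : F))).
  by apply/allP => y; rewrite mem_enum => /roots yk; rewrite rootE !hornerE yk subrr.
by move=> /(_ isT isT); lia.
Qed.
End EtaMinusOne.

Lemma gauss_sum_sqr (C : numClosedFieldType) (F : finFieldType) (p d : nat) :
  prime p -> odd p -> (0 < d)%N -> #|F| = (p ^ d)%N ->
  gauss_sum C p d ^+ 2 = (eta (-1 : F))%:~R * #|F|%:R.
Proof.
move=> p_pr p_odd d_gt0 cF.
have oddF : odd #|F| by rewrite cF oddX p_odd orbT.
rewrite eta_opp1 // /gauss_sum cF -modnXm.
have [p1|p1] := eqVneq (p %% 4)%N 1%N.
  by rewrite p1 exp1n /= mul1r exprMn sqrtCK sqrr_sign mul1r.
have p3 : (p %% 4 = 3)%N by move: p_odd p1 (ltn_pmod p (isT : 0 < 4)%N); lia.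
rewrite !exprMn sqrtCK sqrr_sign mul1r -exprM mulnC exprM sqrCi p3.
congr (_ * _).
have -> : (3 ^ d %% 4)%N = if odd d then 3%N else 1%N.
  by elim: d {d_gt0 cF} => //= d IHd; rewrite expnS -modnMmr IHd; case: odd.
by rewrite -signr_odd; case: odd; rewrite /= ?mulrN1z ?mulr1z.
Qed.

(** * Nowhere-zero flows as sums of [nu] *)

Section Flows.
Variables (F : finFieldType) (G : multigraph) (ini fin : edge G -> vertex G).
Hypothesis noloop : loopless G.
Hypothesis orient : is_orientation ini fin.
Local Notation q := (#|F|%:R : int).
Local Notation V := (vertex G).
Implicit Types (alpha k : {ffun edge G -> F}) (x : {ffun V -> F}).

Lemma ini_neq_fin e : ini e != fin e.
Proof. by have := noloop e; rewrite orient cards2; case: (_ != _). Qed.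

Lemma incidence_delta v e :
  incidence ini fin v e = (v == fin e)%:R - (v == ini e)%:R.
Proof.
rewrite /incidence; have [->|_] := eqVneq v (ini e); last by case: eqP; rewrite subr0.
by rewrite (negPf (ini_neq_fin e)) sub0r.
Qed.

Lemma sum_incidence (x : V -> F) e :
  \sum_v x v * (incidence ini fin v e)%:~R = x (fin e) - x (ini e).
Proof.
have delta u : \sum_v x v * (v == u)%:R = x u.
  rewrite (bigD1 u) //= eqxx mulr1 big1 ?addr0 // => v /negPf ->.
  by rewrite mulr0.
under eq_bigr do rewrite incidence_delta rmorphB /= !natz mulrBr -!pmulrn.
by rewrite sumrB !delta.
Qed.

Lemma flow_pairing k x :
  \sum_e k e * (x (fin e) - x (ini e)) =
  \sum_v x v * \sum_e k e *~ incidence ini fin v e.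
Proof.
under [RHS]eq_bigr do rewrite mulr_sumr.
rewrite exchange_big; apply: eq_bigr => e _ /=.
rewrite -sum_incidence mulr_sumr; apply: eq_bigr => v _.
by rewrite mulrCA mulrzr.
Qed.

(** For a flow every argument is 0. Otherwise conservation fails at some [u], and moving the
    potential at [u] alone makes the argument run through the whole field, where [nu] sums to 0. *)
Lemma nu_flow_sum k :
  \sum_(x : {ffun V -> F}) nu (\sum_e k e * (x (fin e) - x (ini e))) =
  if is_flow ini fin k then (q - 1) * q ^+ #|V| else 0.
Proof.
under eq_bigr do rewrite flow_pairing.
pose D v := \sum_e k e *~ incidence ini fin v e.
case: ifP => [/forallP kf|/negbT/forallPn[u Du]].
  rewrite (eq_bigr (fun=> q - 1)) => [|x _]; last first.
    by rewrite /nu big1 ?eqxx ?mulr1 // => v _; rewrite (eqP (kf v)) mulr0.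
  by rewrite sumr_const card_ffun -natrX mulr_natr.
pose shift t x : {ffun V -> F} := [ffun v => x v + t * (v == u)%:R].
have shiftE t x : \sum_v shift t x v * D v = \sum_v x v * D v + D u * t.
  under eq_bigr do rewrite ffunE mulrDl.
  rewrite big_split /=; congr (_ + _).
  rewrite (bigD1 u) //= eqxx mulr1 mulrC big1 ?addr0 // => v /negPf ->.
  by rewrite mulr0 mul0r.
have shiftK t : cancel (shift t) (shift (- t)).
  by move=> x; apply/ffunP => v; rewrite !ffunE mulNr addrK.
have S t : \sum_(x : {ffun V -> F}) nu (\sum_v x v * D v) =
    \sum_(x : {ffun V -> F}) nu (\sum_v x v * D v + D u * t).
  rewrite (reindex_inj (can_inj (shiftK t))); apply: eq_bigr => x _.
  by rewrite -shiftE.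
(* Adding the [q] equal sums, one for each shift [t], allows summing over [t] first for fixed [x];
   the slope [D u] is nonzero. *)
have qS : q * \sum_(x : {ffun V -> F}) nu (\sum_v x v * D v) = 0.
  rewrite mulr_natl -[in LHS](sumr_const F).
  rewrite (eq_bigr _ (fun t _ => S t)) exchange_big big1 //= => x _.
  exact: nu_sum_affine.
have q0 : q != 0 by rewrite pnatr_eq0 -lt0n; apply/card_gt0P; exists 0.
by apply/eqP; move/eqP: qS; rewrite mulf_eq0 (negPf q0).
Qed.

Lemma nu_weight_rescale :
  \sum_(alpha : {ffun edge G -> F} | nowhere_zero alpha) \sum_(x : {ffun V -> F})
     nu (\sum_e alpha e * (x (fin e) - x (ini e)) ^+ 2) =
  \sum_(k : {ffun edge G -> F} | nowhere_zero k) \sum_(x : {ffun V -> F})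
     nu (\sum_e k e * (x (fin e) - x (ini e))).
Proof.
rewrite exchange_big [RHS]exchange_big; apply: eq_bigr => x _ /=.
(* Where the potential difference is 0, both summands vanish for any weight; the factor 1 there
   keeps the rescaling invertible. *)
pose u e := if x (fin e) - x (ini e) == 0 then 1 else x (fin e) - x (ini e).
have u0 e : u e != 0 by rewrite /u; case: ifP => [_|/negbT //]; exact: oner_neq0.
rewrite [RHS](reindex (fun alpha : {ffun edge G -> F} => [ffun e => alpha e * u e])) /=.
  apply: eq_big => [alpha|alpha _].
    by apply: eq_forallb => e; rewrite ffunE mulf_eq0 (negPf (u0 e)) orbF.
  congr nu; apply: eq_bigr => e _; rewrite ffunE /u -mulrA expr2.
  by case: eqP => [->|//]; rewrite !mulr0.
exists (fun k => [ffun e => k e / u e]) => k _; apply/ffunP => e; rewrite !ffunE.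
  by rewrite mulfK.
by rewrite divfK.
Qed.

Lemma flow_number_nu_sum :
  (q - 1) * q ^+ #|V| * (flow_number ini fin F)%:R =
  \sum_(alpha : {ffun edge G -> F} | nowhere_zero alpha) \sum_(x : {ffun V -> F})
     nu (\sum_e alpha e * (x (fin e) - x (ini e)) ^+ 2).
Proof.
rewrite nu_weight_rescale; under [RHS]eq_bigr do rewrite nu_flow_sum.
rewrite -big_mkcondr sumr_const mulr_natr; congr (_ *+ _).
by rewrite /flow_number cardsE.
Qed.

(** The signs of the orientation cancel in the product. This factorisation makes the Laplacian
    symmetric and its form a weighted sum of squared differences. *)
Lemma lap_coef_incidence e v w :
  lap_coef F e v w =
  (incidence ini fin v e)%:~R * (incidence ini fin w e)%:~R.
Proof.
rewrite !incidence_delta !rmorphB /= !natz -!pmulrn /lap_coef orient !inE.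
have nif := ini_neq_fin e.
have [->|nvi] := eqVneq v (ini e).
  rewrite (negPf nif) /=; have [->|nwi] := eqVneq w (ini e).
    by rewrite (negPf nif) /=; ring.
  by case: (w == fin e) => /=; ring.
have [->|nvf] /= := eqVneq v (fin e); last by ring.
have [->|nwf] := eqVneq w (fin e); first by rewrite eq_sym (negPf nif) /=; ring.
by rewrite orbF; case: (w == ini e) => /=; ring.
Qed.

Lemma laplacian_sym alpha v w : laplacian alpha v w = laplacian alpha w v.
Proof.
by apply: eq_bigr => e _; rewrite !lap_coef_incidence [_%:~R * _]mulrC.
Qed.

Lemma laplacian_form alpha (x : V -> F) :
  \sum_v \sum_w x v * laplacian alpha v w * x w =
  \sum_e alpha e * (x (fin e) - x (ini e)) ^+ 2.
Proof.
transitivity (\sum_v \sum_e \sum_w alpha e *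
    ((x v * (incidence ini fin v e)%:~R) * (x w * (incidence ini fin w e)%:~R))).
  apply: eq_bigr => v _; rewrite exchange_big; apply: eq_bigr => w _.
  rewrite /laplacian mulr_sumr mulr_suml; apply: eq_bigr => e _.
  by rewrite lap_coef_incidence; ring.
rewrite exchange_big; apply: eq_bigr => e _ /=.
rewrite expr2 -!sum_incidence mulr_suml mulr_sumr; apply: eq_bigr => v _.
by rewrite !mulr_sumr.
Qed.

End Flows.

(** * Evaluation of the weight sums *)

(** Concatenates enumerations, so that listing the complement of [W] before [W] makes the relevant
    principal minor an upper left block. *)
Definition join_fun (T : Type) m n (f : 'I_m -> T) (g : 'I_n -> T) (i : 'I_(m + n)) : T :=
  match split i with inl a => f a | inr b => g b end.

Lemma join_fun_lshift (T : Type) m n (f : 'I_m -> T) (g : 'I_n -> T) i :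
  join_fun f g (lshift n i) = f i.
Proof. by rewrite /join_fun (unsplitK (inl i)). Qed.

Lemma join_fun_rshift (T : Type) m n (f : 'I_m -> T) (g : 'I_n -> T) i :
  join_fun f g (rshift m i) = g i.
Proof. by rewrite /join_fun (unsplitK (inr i)). Qed.

Lemma join_fun_inj (T : eqType) m n (f : 'I_m -> T) (g : 'I_n -> T) :
  injective f -> injective g -> (forall i j, f i != g j) -> injective (join_fun f g).
Proof.
move=> finj ginj fg i j; rewrite -(splitK i) -(splitK j).
case: (split i) (split j) => [a|a] [b|b] /=;
  rewrite ?join_fun_lshift ?join_fun_rshift => e.
- by rewrite (finj _ _ e).
- by have := fg a b; rewrite e eqxx.
- by have := fg b a; rewrite e eqxx.
- by rewrite (ginj _ _ e).
Qed.

Lemma codom_join_fun (T : finType) m n (f : 'I_m -> T) (g : 'I_n -> T) v :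
  (v \in codom (join_fun f g)) = (v \in codom f) || (v \in codom g).
Proof.
apply/codomP/orP => [[i ->]|].
  rewrite -(splitK i); case: (split i) => a /=.
    by left; rewrite join_fun_lshift codom_f.
  by right; rewrite join_fun_rshift codom_f.
case=> /codomP[a ->]; first by exists (lshift n a); rewrite join_fun_lshift.
by exists (rshift m a); rewrite join_fun_rshift.
Qed.

Section WeightSum.
Variables (F : finFieldType) (G : multigraph) (ini fin : edge G -> vertex G).
Hypothesis oddF : odd #|F|.
Hypothesis noloop : loopless G.
Hypothesis orient : is_orientation ini fin.
Local Notation q := (#|F|%:R : int).
Local Notation V := (vertex G).
Variable alpha : {ffun edge G -> F}.

Lemma nu_laplacian_qsum n (h : 'I_n -> V) : bijective h ->
  \sum_(x : {ffun V -> F}) nu (\sum_e alpha e * (x (fin e) - x (ini e)) ^+ 2) =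
  nu_qsum (\matrix_(i, j) laplacian alpha (h i) (h j)) 0.
Proof.
case=> g hK gK; rewrite /nu_qsum.
rewrite (reindex (fun y : 'rV[F]_n => [ffun v => y 0 (g v)] : {ffun V -> F})) /=.
  apply: eq_bigr => y _; rewrite add0r; congr nu.
  rewrite -(laplacian_form noloop orient alpha [ffun v => y 0 (g v)]).
  rewrite exchange_big (reindex h) /=; last by exists g => ? _.
  rewrite /qform mxE; apply: eq_bigr => j _.
  rewrite (reindex h) /=; last by exists g => ? _.
  rewrite !mxE mulr_suml; apply: eq_bigr => i _.
  by rewrite !ffunE !hK !mxE.
exists (fun x : {ffun V -> F} => \row_i x (h i)) => y _.
  by apply/rowP => i; rewrite mxE ffunE hK.
by apply/ffunP => v; rewrite ffunE mxE gK.
Qed.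

(** The block on the complement of [W] has determinant [contract_tree_sum alpha W], hence is
    invertible. Larger principal minors belong to proper subsets of [W] and vanish. The free
    coordinates then give [q ^+ #|W|], and [nu_qsum_unit] evaluates the block of size [r]. *)
Lemma nu_weight_sum (W : {set V}) (r := (#|V| - #|W|)%N) : is_Wstar alpha W ->
  \sum_(x : {ffun V -> F}) nu (\sum_e alpha e * (x (fin e) - x (ini e)) ^+ 2) =
  if odd r then 0 else
    (q - 1) * q ^+ (#|W| + r./2) * eta (-1 : F) ^+ r./2 * eta (contract_tree_sum alpha W).
Proof.
case=> W0 sW minW; have two := two_neq0_of_odd_card oddF.
have rE : r = #|~: W| by rewrite [RHS]cardsCs setCK.
pose h (i : 'I_#|~: W|) := enum_val i; pose g (i : 'I_#|W|) := enum_val i.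
have h_inj : injective h := @enum_val_inj _ _.
have g_inj : injective g := @enum_val_inj _ _.
have hW i : h i \in ~: W := enum_valP i.
have gW i : g i \in W := enum_valP i.
have hg i j : h i != g j by apply: contraTneq (hW i) => ->; rewrite inE gW.
have codom_h : codom h =i ~: W.
  move=> v; apply/codomP/idP => [[i ->]|vW]; first exact: hW.
  by exists (enum_rank_in vW v); rewrite /h enum_rankK_in.
pose A := \matrix_(i, j) laplacian alpha (join_fun h g i) (join_fun h g j).
have bij : bijective (join_fun h g).
  apply: inj_card_bij; first exact: join_fun_inj.
  by rewrite card_ord addnC cardsC.
have symA : A^T = A.
  by apply/matrixP => i j; rewrite !mxE (laplacian_sym noloop orient).
have ulA : ulsubmx A = \matrix_(i, j) laplacian alpha (h i) (h j).
  by apply/matrixP => i j; rewrite !mxE !join_fun_lshift.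
have detA : \det (ulsubmx A) = contract_tree_sum alpha W.
  by rewrite ulA -(contract_tree_sum_det noloop alpha h_inj codom_h).
have uA : ulsubmx A \in unitmx by rewrite unitmxE detA unitfE.
have schur0 : schur_compl A = 0.
  apply: (schur_compl_eq0 symA uA) => k t k0 t_inj.
  pose ht := join_fun h (g \o t).
  have ht_inj : injective ht
    by apply: (join_fun_inj h_inj (inj_comp g_inj t_inj)) => i j; apply: hg.
  pose W' : {set V} := [set v | v \notin codom ht].
  have codom_ht : codom ht =i ~: W' by move=> v; rewrite !inE negbK.
  transitivity (contract_tree_sum alpha W').
    rewrite (contract_tree_sum_det noloop alpha ht_inj codom_ht); congr (\det _).
    apply/matrixP => i j; rewrite -(splitK i) -(splitK j).
    by case: (split i) (split j) => [a|a] [b|b] /=;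
      rewrite ?block_mxEul ?block_mxEur ?block_mxEdl ?block_mxEdr !mxE
        /ht ?join_fun_lshift ?join_fun_rshift.
  (* When [t] exhausts [W], minimality says nothing about the empty [W'], but its tree sum is 0
     anyway. *)
  have [->|W'0] := eqVneq W' set0.
    by apply: contract_tree_sum_set0; apply/card_gt0P; exists (g (t (Ordinal k0))).
  apply/eqP; apply: contraTT isT => sW'; have := minW W' W'0 sW'.
  rewrite leqNgt; apply: contraNN => _; apply: proper_card.
  apply/properP; split.
    apply/subsetP => v; rewrite inE codom_join_fun codom_h inE negb_or negbK.
    by case/andP.
  exists (g (t (Ordinal k0))) => //.
  by rewrite inE negbK codom_join_fun (codom_f (g \o t)) orbT.
rewrite (nu_laplacian_qsum bij) (nu_qsum_schur0 symA uA schur0).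
rewrite nu_qsum_unit //; last by rewrite trmx_ulsub symA.
rewrite detA -rE; case: ifP => _; first by rewrite mulr0.
by rewrite exprD; ring.
Qed.
End WeightSum.

Unset Implicit Arguments.
Set Strict Implicit.

Theorem mainTheorem2
    (C : numClosedFieldType)
    (G : multigraph) (hloop : loopless G) (hconn : connected G)
    (ini fin : edge G -> vertex G) (horient : is_orientation ini fin)
    (p d : nat) (hp : prime p) (hodd : odd p) (hd : (1 <= d)%N)
    (F : finFieldType) (hF : #|F| = (p ^ d)%N)
    (Wstar : {ffun edge G -> F} -> {set vertex G})
    (hWstar : forall alpha : {ffun edge G -> F},
        nowhere_zero alpha -> is_Wstar alpha (Wstar alpha)) :
  (flow_number ini fin F)%:R =
  \sum_(0 <= r < #|vertex G| | ~~ odd r)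
     (gauss_sum C p d / (p ^ d)%N%:R) ^+ r * (eta_sum Wstar r)%:~R.
Proof.
have oddF : odd #|F| by rewrite hF oddX hodd orbT.
have q_gt1 : (1 < #|F|)%N := finNzRing_gt1 F.
have gE := gauss_sum_sqr C hp hodd hd hF.
rewrite -hF; set q : C := #|F|%:R; set g := gauss_sum C p d in gE *.
have q0 : q != 0 by rewrite pnatr_eq0; case: #|F| q_gt1.
have q1 : q - 1 != 0 by rewrite subr_eq0 pnatr_eq1; case: #|F| q_gt1 => [|[]].
pose r alpha := rstar Wstar alpha.
have term (alpha : {ffun edge G -> F}) : nowhere_zero alpha ->
  (\sum_(x : {ffun vertex G -> F})
     nu (\sum_e alpha e * (x (fin e) - x (ini e)) ^+ 2))%:~R =
  (q - 1) * q ^+ #|vertex G| * (if odd (r alpha) then 0 else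
    (g / q) ^+ r alpha * (eta (contract_tree_sum alpha (Wstar alpha)))%:~R).
  move=> nz; rewrite (nu_weight_sum oddF hloop horient (hWstar _ nz)) -/(rstar _ _) -/(r alpha).
  case: ifP => [_|/negbT even_r]; first by rewrite mulr0.
  have rE : r alpha = (2 * (r alpha)./2)%N.
    by rewrite mul2n -[LHS]odd_double_half (negPf even_r).
  have VE : #|vertex G| = (#|Wstar alpha| + r alpha)%N.
    by rewrite /r /rstar subnKC // max_card.
  (* As [r alpha] is even, the square of the Gauss sum suffices. *)
  have -> : (g / q) ^+ r alpha = ((eta (-1 : F))%:~R / q) ^+ (r alpha)./2.
    by rewrite {1}rE exprM expr_div_n gE -/q; congr (_ ^+ _); field.
  rewrite !rmorphM /= !rmorphXn rmorphB /= rmorph_nat rmorph1 -/q VE.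
  set k := (r alpha)./2 in rE *.
  have -> : (#|Wstar alpha| + r alpha = #|Wstar alpha| + k + k)%N by rewrite rE; lia.
  rewrite exprMn exprVn [q ^+ (_ + k + k)]exprD.
  field; exact: expf_neq0.
(* A minimum set is nonempty, so every [alpha] has its rank in the summation range. *)
have r_lt alpha : nowhere_zero alpha -> (r alpha < #|vertex G|)%N.
  move=> nz; have [W0 _ _] := hWstar _ nz; have /set0Pn[v _] := W0.
  rewrite /r /rstar -subn_gt0 subKn ?max_card //; last by rewrite card_gt0.
have qV : (q - 1) * q ^+ #|vertex G| != 0 by rewrite mulf_neq0 ?expf_neq0.
apply: (mulfI qV).
have := congr1 (fun z : int => z%:~R : C) (flow_number_nu_sum F hloop horient).
rewrite /= !rmorphM /= rmorphXn rmorphB /= !rmorph_nat rmorph1 -/q => ->.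
rewrite rmorph_sum /= (eq_bigr _ term) -mulr_sumr; congr (_ * _).
rewrite big_mkord [RHS](eq_bigr (fun i : 'I__ => \sum_(alpha : {ffun edge G -> F} |
    nowhere_zero alpha && (r alpha == i))
    (g / q) ^+ r alpha * (eta (contract_tree_sum alpha (Wstar alpha)))%:~R)); last first.
  move=> i _; rewrite /eta_sum rmorph_sum mulr_sumr.
  by apply: eq_bigr => alpha /andP[_ /eqP <-].
(* With the sum over [alpha] outside, each [alpha] of even rank meets exactly one index, its own
   [r alpha]. *)
rewrite [RHS](exchange_big_dep (fun alpha => nowhere_zero alpha && ~~ odd (r alpha))) /=;
  last by move=> i alpha odd_i /andP[-> /eqP ->].
rewrite [LHS](eq_bigr (fun alpha => if ~~ odd (r alpha) then
  (g / q) ^+ r alpha * (eta (contract_tree_sum alpha (Wstar alpha)))%:~R else 0));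
    last first.
  by move=> alpha _; case: odd.
rewrite -big_mkcondr; apply: eq_bigr => alpha /andP[nz even_r].
rewrite (big_pred1 (Ordinal (r_lt alpha nz))) // => i.
rewrite nz /= -val_eqE /= eq_sym.
by case: eqP => [->|_]; rewrite ?even_r ?andbF.
Qed.
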